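(* $r_7(\mathbb{F}_7^3)<243$.
   Context: $r_7(\mathbb{F}_7^3)$ denotes the maximum cardinality of a subset of $\mathbb{F}_7^3$ containing no $7$-progression, i.e. no set $\{a+ib : i\in\{0,1,\dots,6\}\}$ with $a,b\in\mathbb{F}_7^3$, $b\neq 0$; equivalently, containing no full affine line of $\mathbb{F}_7^3$. *)

(* Defs.v *)
From HB Require Import structures.
From mathcomp Require Import all_boot all_order all_algebra.

Set Implicit Arguments.
Unset Strict Implicit.
Unset Printing Implicit Defensive.

Import GRing.Theory.
Local Open Scope ring_scope.

Definition progression (p n k : nat) (a b : 'rV['F_p]_n) : {set 'rV['F_p]_n} :=
  [set a + b *+ (i : nat) | i : 'I_k].

Definition progression_free (p n k : nat) (A : {set 'rV['F_p]_n}) : bool :=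
  [forall a : 'rV['F_p]_n, forall b : 'rV['F_p]_n,
     (b != 0) ==> ~~ (progression k a b \subset A)].

(* r_k(F_p^n), for p prime and 1 <= k <= p; set0 is then progression-free, so
   the maximum ranges over a nonempty family. *)
Definition r_ (k p n : nat) : nat :=
  (\max_(A : {set 'rV['F_p]_n} | progression_free k A) #|A|)%N.

(* Main.v *)
Require Import Defs.
From mathcomp Require Import all_boot all_order all_algebra.
From mathcomp Require Import mxabelem zify ring.

(* Suppose a line-free set had 243 points; its complement B would have 100
   points and meet every line.  By Jamison's theorem every plane meets B in
   13 + x points with x >= 0, and x <= 9 since parallel planes share the 100
   points.  Let t be the number of tangents (lines meeting B in one point) of a
   plane.  The eight planes through a tangent have total excess 3, so
   sum t (8 x - 3) = 0 over all planes, and t = 0 when x > 3; counting points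
   and pairs of points of B along the lines of a plane bounds t in terms of x.
   Altogether t (8 x - 3) <= -54 + 276 x - 30 x^2 for each plane.  Counting the
   pairs of points of B makes the right-hand side sum to -3888 over the 399
   planes, which contradicts the identity.

   Planes are handled as pairs (w, c) with w <> 0 and lines as pairs (p, d) with
   d <> 0, so each plane is counted 6 times and each line 42 times. *)

Set Implicit Arguments.
Unset Strict Implicit.
Unset Printing Implicit Defensive.

Import Order.TTheory GRing.Theory Num.Theory.
Local Open Scope ring_scope.

(** * Power sums over a finite field and Jamison's theorem in the affine plane *)

Section AffinePlane.

Variable F : finFieldType.

(** For i > 0, ['X^i - 1] has fewer than q - 1 roots, so some nonzero x has x^i <> 1; substituting x
    y for y multiplies the sum by x^i. *)
Lemma sum_expf_lt (i : nat) : (i < #|F|.-1)%N -> \sum_(x : F) x ^+ i = 0.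
Proof.
move=> lt_i; case: (posnP i) => [-> | i_gt0].
  (* The sum is |F| times 1, which is what translation by 1 adds to the unchanged sum of all
     elements. *)
  have := reindex_inj (addIr (1 : F)) (P := xpredT) (F := id) (op := +%R) (x := 0).
  rewrite /= big_split /= -{1}[LHS]addr0 => /addrI sum1.
  by rewrite [RHS]sum1.
have [x xN0 xiN1] : exists2 x : F, x != 0 & x ^+ i != 1.
  apply/exists_inP; apply: contraLR lt_i => /exists_inPn all1.
  rewrite -leqNgt -(cardC1 (0 : F)) cardE.
  apply: max_unity_roots => //; last exact: enum_uniq.
  apply/allP => x; rewrite mem_enum => xN0.
  by rewrite unity_rootE; have := all1 x xN0; rewrite negbK.
have : \sum_y y ^+ i = x ^+ i * \sum_y y ^+ i.
  rewrite [LHS](reindex_inj (mulfI xN0)) /= big_distrr /=.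
  by apply: eq_bigr => y _; rewrite exprMn.
move/eqP; rewrite -subr_eq0 -{1}[\sum_y _]mul1r -mulrBl mulf_eq0 subr_eq0 eq_sym.
by rewrite (negPf xiN1) => /eqP.
Qed.

(** Expanding one factor raises the degree by at most 1, hence the induction over all exponents.
    Once L is empty, i or j is below q - 1 and its power sum vanishes. *)
Lemma sum_prod_affine (L : seq (F * F)) (i j : nat) :
    (i + j + size L < 2 * #|F|.-1)%N ->
  \sum_u \sum_v u ^+ i * v ^+ j * \prod_(a <- L) (1 - (u * a.1 + v * a.2)) = 0.
Proof.
elim: L i j => [|a L IHL] i j /= lt_deg.
  under eq_bigr do under eq_bigr do rewrite big_nil mulr1.
  under eq_bigr do rewrite -big_distrr.
  rewrite -big_distrl /=.
  case: (ltnP i #|F|.-1) => [lt_i | le_i]; first by rewrite sum_expf_lt ?mul0r.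
  have lt_j : (j < #|F|.-1)%N by move: lt_deg le_i; set q := #|F|.-1; lia.
  by rewrite [X in _ * X]sum_expf_lt ?mulr0.
pose S i j := \sum_u \sum_v u ^+ i * v ^+ j *
  \prod_(a <- L) (1 - (u * a.1 + v * a.2)).
transitivity (S i j - (a.1 * S i.+1 j + a.2 * S i j.+1)); last first.
  by rewrite /S !IHL ?mulr0 ?addr0 ?subr0 //; move: lt_deg; set q := #|F|.-1; lia.
rewrite /S !big_distrr -big_split -sumrB /=; apply: eq_bigr => u _.
rewrite !big_distrr -big_split -sumrB /=; apply: eq_bigr => v _.
rewrite big_cons !exprS; ring.
Qed.

(* Jamison's bound.  With a point of P moved to the origin, the product of the
   forms 1 - (b, -) over the other points b vanishes everywhere except at 0, so
   its sum over the plane is 1; a product of fewer than 2(q - 1) affine forms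
   has sum 0. *)
Lemma affine_blocking_card (P : {set F * F}) :
    (forall u v c : F, (u != 0) || (v != 0) ->
       exists2 a, a \in P & u * a.1 + v * a.2 = c) ->
  (2 * #|F|.-1 < #|P|)%N.
Proof.
move=> blockP.
have [o oP _] : exists2 a, a \in P & 1 * a.1 + 0 * a.2 = 0.
  by apply: blockP; rewrite oner_neq0.
rewrite (cardsD1 o) oP add1n ltnS leqNgt; apply/negP => lt_card.
pose L := [seq (a.1 - o.1, a.2 - o.2) | a <- enum (P :\ o)].
have vanish u v : (u != 0) || (v != 0) ->
    \prod_(a <- L) (1 - (u * a.1 + v * a.2)) = 0.
  (* This line misses [o], where the form is smaller by 1; so it meets [P] in another point, whose
     factor vanishes. *)
  move=> uvN0; have [a aP eq_a] := blockP u v (1 + (u * o.1 + v * o.2)) uvN0.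
  have aNo : a != o.
    apply: contra_eq_neq eq_a => ->.
    by rewrite -subr_eq0 opprD addrCA subrr addr0 oppr_eq0 oner_eq0.
  apply/eqP; rewrite prodf_seq_eq0; apply/hasP.
  exists (a.1 - o.1, a.2 - o.2) => /=.
    by apply/mapP; exists a; rewrite // mem_enum !inE aNo.
  have -> : u * (a.1 - o.1) + v * (a.2 - o.2)
      = u * a.1 + v * a.2 - (u * o.1 + v * o.2) by ring.
  by rewrite eq_a addrK subrr.
have ltL : (0 + 0 + size L < 2 * #|F|.-1)%N by rewrite size_map -cardE.
move/eqP: (sum_prod_affine ltL).
rewrite (bigD1 0) //= (bigD1 0) //= !expr0 !mul1r.
rewrite [X in _ + X + _]big1 => [|v vN0]; last first.
  by rewrite vanish ?mulr0 // vN0 orbT.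
rewrite [X in _ + X]big1 => [|u uN0]; last first.
  by apply: big1 => v _; rewrite vanish ?mulr0 // uN0.
rewrite !addr0 big1 => [|a _]; first by rewrite oner_eq0.
by rewrite !mul0r addr0 subr0.
Qed.
End AffinePlane.

(** * Orthogonality and its counts over a finite field *)

Lemma card_lker_mx (F : finFieldType) (m n : nat) (A : 'M[F]_(m, n)) :
  #|[pred w : 'rV[F]_m | w *m A == 0]| = (#|F| ^ (m - \rank A))%N.
Proof.
rewrite -mxrank_ker -card_rowg; apply: eq_card => w.
by rewrite !inE; apply/eqP/sub_kermxP.
Qed.

Section Dot.

Variables (F : finFieldType) (m : nat).
Implicit Types (w p q d e : 'rV[F]_m) (c s t : F).

Definition dot w p : F := (w *m p^T) 0 0.

Lemma dotDr w p q : dot w (p + q) = dot w p + dot w q.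
Proof. by rewrite /dot linearD mulmxDr mxE. Qed.

Lemma dotNr w p : dot w (- p) = - dot w p.
Proof. by rewrite /dot linearN mulmxN mxE. Qed.

Lemma dotBr w p q : dot w (p - q) = dot w p - dot w q.
Proof. by rewrite dotDr dotNr. Qed.

Lemma dotZr w s p : dot w (s *: p) = s * dot w p.
Proof. by rewrite /dot linearZ -scalemxAr mxE. Qed.

Lemma dotZl w s p : dot (s *: w) p = s * dot w p.
Proof. by rewrite /dot -scalemxAl mxE. Qed.

Lemma dot0l p : dot 0 p = 0.
Proof. by rewrite /dot mul0mx mxE. Qed.

Lemma dotC w p : dot w p = dot p w.
Proof. by rewrite /dot -[w *m _]trmxK trmx_mul trmxK mxE. Qed.

Lemma dot_eq0 w p : (dot w p == 0) = (w *m p^T == 0).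
Proof.
apply/eqP/eqP => [wp0 | wp0]; last by rewrite /dot wp0 mxE.
by apply/matrixP => i j; rewrite !ord1 [RHS]mxE.
Qed.

Lemma dot_surj w c : w != 0 -> exists p, dot w p = c.
Proof.
move=> /rV0Pn[i wiN0]; exists ((c / w 0 i) *: delta_mx 0 i).
rewrite dotZr /dot trmx_delta mxE (bigD1 i) //= big1 => [|j jNi].
  by rewrite mxE !eqxx mulr1 addr0 divfK.
by rewrite mxE (negPf jNi) mulr0.
Qed.

Lemma card_orth d : d != 0 -> #|[pred w | dot w d == 0]| = (#|F| ^ m.-1)%N.
Proof.
move=> dN0; transitivity #|[pred w : 'rV[F]_m | w *m d^T == 0]|.
  by apply: eq_card => w; rewrite !inE dot_eq0.
by rewrite card_lker_mx mxrank_tr rank_rV dN0 subn1.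
Qed.

Lemma card_orth2 d e : d != 0 -> ~~ (e <= d)%MS ->
  #|[pred w | (dot w d == 0) && (dot w e == 0)]| = (#|F| ^ m.-2)%N.
Proof.
move=> dN0 eNd.
transitivity #|[pred w : 'rV[F]_m | w *m (col_mx d e)^T == 0]|.
  apply: eq_card => w; rewrite !inE !dot_eq0 tr_col_mx mul_mx_row.
  by rewrite -[0 in RHS]row_mx0; apply/andP/eqP => [[/eqP-> /eqP->] //|/eq_row_mx[-> ->]].
rewrite card_lker_mx mxrank_tr -addsmxE; congr (_ ^ _)%N.
suff -> : \rank (d + e)%MS = 2%N by rewrite subn2.
apply/eqP; rewrite eqn_leq; apply/andP; split.
  by rewrite (leq_trans (mxrank_adds_leqif _ _)) // (leq_add (rank_leq_row d)) ?rank_leq_row.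
have : (d < d + e)%MS by rewrite ltmxE addsmxSl addsmx_sub submx_refl.
by move/rank_ltmx; rewrite rank_rV dN0.
Qed.

End Dot.

(** Provides coordinates on the planes with normal w, through which the planar bound is transferred
    to space. *)
Lemma orth_plane_basis (F : finFieldType) (w : 'rV[F]_3) : w != 0 ->
  exists e f : 'rV[F]_3, [/\ dot w e = 0, dot w f = 0 &
    forall s t, s *: e + t *: f = 0 -> s = 0 /\ t = 0].
Proof.
move=> wN0.
have [M Mfree Mw] : exists2 M : 'M[F]_(2, 3), row_free M & M *m w^T = 0.
  have rk2 : \rank (kermx w^T) = 2%N by rewrite mxrank_ker mxrank_tr rank_rV wN0.
  have Kfree := row_base_free (kermx w^T).
  have /sub_kermxP Kw : (row_base (kermx w^T) <= kermx w^T)%MS by rewrite eq_row_base.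
  by move: (row_base _) Kfree Kw; rewrite rk2 => M; exists M.
have dotM i : dot w (row i M) = 0.
  by apply/eqP; rewrite dotC dot_eq0 -row_mul Mw row0.
exists (row 0 M), (row 1 M); split=> // s t st0.
pose u : 'rV[F]_2 := \row_j (if j == 0 then s else t).
have u0 : u = 0.
  apply: (row_free_inj Mfree); rewrite /= mul0mx -[RHS]st0.
  rewrite mulmx_sum_row big_ord_recl big_ord1 !mxE /=.
  by congr (_ + _ *: row _ _); apply: val_inj.
by split; [have := congr1 (fun v : 'rV_2 => v 0 0) u0
          | have := congr1 (fun v : 'rV_2 => v 0 1) u0]; rewrite !mxE.
Qed.

(* Quadratics interpolating the indicator of 1 at k = 1, 2, 7 and 1, 3, 4. *)
Lemma indicator1_bounds (k : int) : 1 <= k <= 7 ->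
  14 + (- 9) * k + 1 * k ^+ 2 <= 6 * (k == 1)%:R <= 12 + (- 7) * k + 1 * k ^+ 2.
Proof. by case: k => // -[|[|[|[|[|[|[|[|n]]]]]]]]. Qed.

Lemma sum_constz (I : finType) (P : pred I) (x : int) :
  \sum_(i | P i) x = x * #|P|%:R.
Proof. by rewrite sumr_const mulr_natr. Qed.

(** * Incidence counts over the planes of space *)

Section BlockingSet.

Variable F : finFieldType.
Hypothesis card_F : #|F| = 7%N.
Local Notation V := 'rV[F]_3.
Variable B : {set V}.
Hypothesis card_B : #|B| = 100%N.
Hypothesis block_B : forall p d : V, d != 0 -> exists s, p + s *: d \in B.
Implicit Types (w p q d e : V) (c s t : F).

Definition indB p : int := (p \in B)%:R.
Definition plane_card w c : int := \sum_(p | dot w p == c) indB p.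
Definition line_card p d : int := \sum_s indB (p + s *: d).

Lemma sum_indB : \sum_p indB p = 100.
Proof. by rewrite -natr_sum -big_mkcond /= sum1_card card_B. Qed.

Lemma indB_idem p : indB p * indB p = indB p.
Proof. by rewrite /indB; case: (p \in B); rewrite ?mulr1 ?mulr0. Qed.

Lemma cardZ_orth d : d != 0 ->
  #|[pred w | (w != 0) && (dot w d == 0)]| = 48%N.
Proof.
move=> dN0; apply: (@addnI 1%N); rewrite [RHS](_ : _ = #|F| ^ 3.-1)%N ?card_F //.
rewrite -card_F -(card_orth dN0) [RHS](cardD1 0) inE dot0l eqxx; congr (_ + _)%N.
Qed.

Lemma cardZ_orth2 d e : d != 0 ->
  #|[pred w | [&& w != 0, dot w d == 0 & dot w e == 0]]|
    = (if (e <= d)%MS then 48 else 6)%N.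
Proof.
move=> dN0; case: ifPn => [/sub_rVP[s ->] | eNd].
  rewrite -(cardZ_orth dN0); apply: eq_card => w; rewrite !inE dotZr.
  by case: (dot w d =P 0) => [->|]; rewrite ?mulr0 ?eqxx ?andbF.
apply: (@addnI 1%N); rewrite [RHS](_ : _ = #|F| ^ 3.-2)%N ?card_F //.
rewrite -card_F -(card_orth2 dN0 eNd) [RHS](cardD1 0) inE !dot0l eqxx; congr (_ + _)%N.
Qed.

Lemma card_plane w c : w != 0 -> #|[pred p | dot w p == c]| = 49%N.
Proof.
move=> wN0; have [p0 <-] := dot_surj c wN0.
rewrite [RHS](_ : _ = #|F| ^ 3.-1)%N ?card_F // -[in RHS]card_F -(card_orth wN0).
rewrite -[RHS](card_image (addIr p0)); apply: eq_card => p; rewrite !inE.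
apply/eqP/imageP => [eq_p | [q + ->]]; last first.
  by rewrite inE dotC dotDr => /eqP ->; rewrite add0r.
exists (p - p0); last by rewrite subrK.
by rewrite inE dotC dotBr eq_p subrr.
Qed.

Lemma sum_plane_card w : \sum_c plane_card w c = 100.
Proof.
rewrite -sum_indB [RHS](partition_big (dot w) xpredT) //=.
Qed.

Lemma sum_plane_card_mul (f : V -> F -> int) w :
  \sum_c plane_card w c * f w c = \sum_p indB p * f w (dot w p).
Proof.
rewrite [RHS](partition_big (dot w) xpredT) //=; apply: eq_bigr => c _.
by rewrite big_distrl /=; apply: eq_bigr => p /eqP ->.
Qed.

Lemma sum_line p d : d != 0 ->
  \sum_(q | (q - p <= d)%MS) indB q = line_card p d.
Proof.
move=> dN0; pose l := [set p + s *: d | s in F].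
transitivity (\sum_(q in l) indB q).
  apply: eq_bigl => q; apply/sub_rVP/imsetP => [[s eq_q] | [s _ ->]].
    by exists s; rewrite // -eq_q addrC subrK.
  by exists s; rewrite addrC addKr.
rewrite big_imset //= => s t _ _ /addrI/eqP.
by rewrite -subr_eq0 -scalerBl scaler_eq0 (negPf dN0) orbF subr_eq0 => /eqP.
Qed.

(** Double counting: a point q <> p is met by the 48 normals orthogonal to q - p, and p itself by
    all 342; 294 = 342 - 48. *)
Lemma sum_planes_through_point p :
  \sum_(w | w != 0) plane_card w (dot w p) = 4800 + 294 * indB p.
Proof.
rewrite /plane_card (exchange_big_dep xpredT) //=.
rewrite (eq_bigr (fun q => indB q * 48 + (if q == p then indB q * 294 else 0))).
  by rewrite big_split /= -big_distrl /= -big_mkcond big_pred1_eq sum_indB; ring.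
move=> q _; rewrite sum_constz; have [-> | qNp] := eqVneq q p.
  transitivity (indB p * 342%:R); last by ring.
  congr (_ * _%:R); rewrite [RHS](_ : _ = (7 ^ 3).-1)%N //.
  rewrite -card_F -[(_ ^ 3)%N]/(#|F| ^ (1 * 3))%N -card_mx -(cardC1 (0 : V)).
  by apply: eq_card => w; rewrite !inE unfold_in eqxx andbT.
rewrite addr0; congr (_ * _%:R); rewrite -(@cardZ_orth (q - p)) ?subr_eq0 //.
by apply: eq_card => w; rewrite !inE unfold_in dotBr subr_eq0.
Qed.

(** Each point of B on the line is counted 48 times and each one off it 6 times; 42 = 48 - 6. *)
Lemma sum_planes_through_line p d : d != 0 ->
  \sum_(w | (w != 0) && (dot w d == 0)) plane_card w (dot w p)
    = 600 + 42 * line_card p d.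
Proof.
move=> dN0; rewrite /plane_card (exchange_big_dep xpredT) //=.
rewrite (eq_bigr (fun q => indB q * 6 + (if (q - p <= d)%MS then indB q * 42 else 0))).
  by rewrite big_split /= -big_distrl /= -big_mkcond -big_distrl /= sum_line // sum_indB; ring.
move=> q _; rewrite sum_constz.
rewrite (@eq_card _ _ [pred w | [&& w != 0, dot w d == 0 & dot w (q - p) == 0]]).
  by rewrite cardZ_orth2 //; case: ifP => _; ring.
by move=> w; rewrite !inE unfold_in dotBr subr_eq0 andbA.
Qed.

(** The sum runs over the points of B, each weighted by the total size of the planes through it,
    4800 + 294 = 5094. *)
Lemma sum_sqr_plane_card :
  \sum_(w | w != 0) \sum_c plane_card w c ^+ 2 = 5094 * 100.
Proof.
under eq_bigr => w _ do rewrite (sum_plane_card_mul plane_card).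
rewrite exchange_big /=.
rewrite (eq_bigr (fun p => indB p * 5094)) => [|p _].
  by rewrite -big_distrl /= sum_indB mulrC.
rewrite -big_distrr /= sum_planes_through_point mulrDr mulrCA indB_idem; ring.
Qed.

(** * Line counts inside one plane *)

Lemma shift_plane w c d (f : V -> int) : dot w d = 0 ->
  \sum_(p | dot w p == c) f (p + d) = \sum_(p | dot w p == c) f p.
Proof.
move=> wd0; rewrite [RHS](reindex_inj (addIr d)) /=.
by apply: eq_bigl => p; rewrite dotDr wd0 addr0.
Qed.

Lemma sum_line_card w c : w != 0 ->
  \sum_(d | (d != 0) && (dot w d == 0)) \sum_(p | dot w p == c) line_card p d
    = 336 * plane_card w c.
Proof.
move=> wN0.
rewrite (eq_bigr (fun _ => 7 * plane_card w c)) => [|d /andP[_ /eqP wd0]].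
  rewrite sum_constz.
  rewrite (@eq_card _ _ [pred d | (d != 0) && (dot d w == 0)]) => [|d]; last first.
    by rewrite !inE unfold_in dotC.
  rewrite cardZ_orth //.
  by ring.
rewrite exchange_big /= (eq_bigr (fun _ => plane_card w c)) => [|s _].
  by rewrite sum_constz card_F mulrC.
by rewrite (@shift_plane w c (s *: d) indB) // dotZr wd0 mulr0.
Qed.

Lemma sum_pairs w c : w != 0 ->
  \sum_(d | (d != 0) && (dot w d == 0)) \sum_(p | dot w p == c) indB p * indB (p + d)
    = plane_card w c * (plane_card w c - 1).
Proof.
move=> wN0; rewrite exchange_big /= big_distrl /=; apply: eq_bigr => p /eqP wp.
rewrite -big_distrr /= mulrBr mulr1.
have -> : plane_card w c = indB p + \sum_(d | (d != 0) && (dot w d == 0)) indB (p + d).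
  transitivity (\sum_(d | dot w d == 0) indB (p + d)).
    rewrite /plane_card (reindex_inj (addrI p)) /=; apply: eq_bigl => d.
    by rewrite dotDr wp -[X in _ == X]addr0 (inj_eq (addrI c)).
  rewrite (bigD1 0) /=; last by rewrite dotC dot0l.
  by rewrite addr0; congr (_ + _); apply: eq_bigl => d; rewrite andbC.
by rewrite mulrDr indB_idem addrC addKr.
Qed.

(** The square counts pairs p + s d, p + (s + r) d. Shifting by s d gives a factor 7; r = 0
    contributes the 48 directions, and for each of the 6 other r rescaling d by r gives
    [sum_pairs]. *)
Lemma sum_sqr_line_card w c : w != 0 ->
  \sum_(d | (d != 0) && (dot w d == 0)) \sum_(p | dot w p == c) line_card p d ^+ 2
    = 336 * plane_card w c + 42 * (plane_card w c * (plane_card w c - 1)).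
Proof.
move=> wN0.
pose G d := \sum_(p | dot w p == c) indB p * indB (p + d).
transitivity (\sum_(d | (d != 0) && (dot w d == 0)) 7 * \sum_r G (r *: d)).
  apply: eq_bigr => d /andP[_ /eqP wd0].
  transitivity (\sum_(p | dot w p == c) \sum_s \sum_r indB (p + s *: d) * indB (p + s *: d + r *: d)).
    apply: eq_bigr => p _; rewrite expr2 {1}/line_card big_distrl /=.
    apply: eq_bigr => s _; rewrite big_distrr /=.
    rewrite (reindex_inj (addrI s)) /=; apply: eq_bigr => r _.
    by rewrite scalerDl addrA.
  rewrite exchange_big /= (eq_bigr (fun _ => \sum_r G (r *: d))) => [|s _].
    by rewrite sum_constz card_F mulrC.
  rewrite exchange_big /=; apply: eq_bigr => r _.
  rewrite (@shift_plane w c (s *: d) (fun q => indB q * indB (q + r *: d))) //.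
  by rewrite dotZr wd0 mulr0.
rewrite -big_distrr exchange_big (bigD1 0) //=.
rewrite (eq_bigr (fun _ => plane_card w c)) => [|d _]; last first.
  by apply: eq_bigr => p _; rewrite scale0r addr0 indB_idem.
rewrite sum_constz.
rewrite (@eq_card _ _ [pred d | (d != 0) && (dot d w == 0)]) => [|d]; last first.
  by rewrite !inE unfold_in dotC.
rewrite cardZ_orth //.
rewrite (eq_bigr (fun _ => plane_card w c * (plane_card w c - 1))) => [|r rN0]; last first.
  rewrite -sum_pairs // [RHS](reindex_inj (scalerI rN0)) /=.
  apply: eq_bigl => d; rewrite scaler_eq0 (negPf rN0) /= dotZr mulf_eq0.
  by rewrite (negPf rN0).
rewrite sum_constz cardC1 card_F /=; ring.
Qed.

(** * Sizes of plane sections *)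

Lemma plane_card_ge w c : w != 0 -> 13 <= plane_card w c.
Proof.
move=> wN0; have [p0 wp0] := dot_surj c wN0.
have [e [f [we wf ef_free]]] := orth_plane_basis wN0.
pose emb (a : F * F) := p0 + (a.1 *: e + a.2 *: f).
have emb_inj : injective emb.
  move=> [a1 a2] [a1' a2'] /addrI/eqP /=; rewrite -subr_eq0 => /eqP eq0.
  have [] := ef_free (a1 - a1') (a2 - a2').
    by rewrite -[RHS]eq0 !scalerBl opprD addrACA.
  by move=> /eqP; rewrite subr_eq0 => /eqP-> /eqP; rewrite subr_eq0 => /eqP->.
have block2 (u v c' : F) : (u != 0) || (v != 0) ->
    exists2 a, a \in emb @^-1: B & u * a.1 + v * a.2 = c'.
  move=> uvN0.
  have [a eq_a] : exists a : F * F, u * a.1 + v * a.2 = c'.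
    case/orP: uvN0 => N0; [exists (c' / u, 0) | exists (0, c' / v)].
      by rewrite mulr0 addr0 mulrC divfK.
    by rewrite mulr0 add0r mulrC divfK.
  (* The direction of the planar line u x + v y = c', carried into space. *)
  have dN0 : (- v) *: e + u *: f != 0.
    by apply: contraTneq uvN0 => /ef_free[/eqP + ->]; rewrite oppr_eq0 eqxx => ->.
  have [s sB] := block_B (emb a) dN0.
  exists (a.1 - s * v, a.2 + s * u) => /=; last by rewrite -eq_a; ring.
  rewrite inE; move: sB; congr (_ \in B); rewrite /emb -addrA; congr (_ + _) => /=.
  by rewrite !scalerDl scalerDr !scalerA mulrN scaleNr addrACA -scaleNr -mulrN.
have := affine_blocking_card block2; rewrite card_F => card_gt.
have -> : plane_card w c = #|[set p in B | dot w p == c]|%:R.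
  rewrite /plane_card -natr_sum -big_mkcondr sum1_card; congr (_%:R).
  by apply: eq_card => p; rewrite !inE unfold_in andbC.
rewrite ler_nat (leq_trans card_gt) // -(card_imset _ emb_inj) subset_leq_card //.
apply/subsetP => _ /imsetP[a aB ->]; rewrite inE in aB.
by rewrite !inE aB /emb !dotDr !dotZr we wf !mulr0 !addr0 wp0 eqxx.
Qed.

(** The six parallel planes take at least 6 * 13 of the 100 points. *)
Lemma plane_card_le w c : w != 0 -> plane_card w c <= 22.
Proof.
move=> wN0; have := sum_plane_card w; rewrite (bigD1 c) //=.
have : \sum_(c' | c' != c) 13 <= \sum_(c' | c' != c) plane_card w c'.
  by apply: ler_sum => c' _; apply: plane_card_ge.
rewrite sum_constz cardC1 card_F; move: (plane_card w c) (\sum_(_ | _) _) => n r.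
lia.
Qed.

Lemma line_card_bounds p d : d != 0 -> 1 <= line_card p d <= 7.
Proof.
move=> dN0; have [s sB] := block_B p dN0.
have indB01 q : 0 <= indB q <= 1 by rewrite /indB; case: (q \in B).
apply/andP; split.
  rewrite /line_card (bigD1 s) //= {1}/indB sB lerDl; apply: sumr_ge0 => t _.
  by case/andP: (indB01 (p + t *: d)).
have : line_card p d <= \sum_(t : F) 1.
  by apply: ler_sum => t _; case/andP: (indB01 (p + t *: d)).
by rewrite sum_constz card_F.
Qed.

Lemma plane_cardZ (r : F) w c : r != 0 ->
  plane_card (r *: w) (r * c) = plane_card w c.
Proof.
by move=> rN0; apply: eq_bigl => p; rewrite dotZl (inj_eq (mulfI rN0)).
Qed.

Lemma tangent_plane_card w p d : w != 0 -> d != 0 -> dot w d = 0 ->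
  line_card p d = 1 -> plane_card w (dot w p) <= 16.
Proof.
move=> wN0 dN0 wd0 k1.
(* The six normals that describe the same plane through p as w. *)
pose W := [set r *: w | r in predC1 (0 : F)].
pose g w' := plane_card w' (dot w' p) - 13.
have sumW : \sum_(w' in W) g w' = 6 * g w.
  rewrite big_imset /= => [|r t _ _ /eqP]; last first.
    by rewrite -subr_eq0 -scalerBl scaler_eq0 (negPf wN0) orbF subr_eq0 => /eqP.
  rewrite (eq_bigr (fun _ => g w)) => [|r rN0]; last by rewrite /g dotZl plane_cardZ.
  by rewrite sum_constz cardC1 card_F mulrC.
(* 600 + 42 - 13 * 48 = 18, the excess 3 with each plane counted 6 times. *)
have : \sum_(w' | (w' != 0) && (dot w' d == 0)) g w' = 18.
  rewrite sumrB sum_planes_through_line // k1 sum_constz cardZ_orth //.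
rewrite (bigID (mem W)) /=.
rewrite (eq_bigl (mem W)) => [|w'] /=; last first.
  apply: andb_idl => /imsetP[r rN0 ->].
  by rewrite scaler_eq0 (negPf rN0) (negPf wN0) dotZl wd0 mulr0 eqxx.
rewrite sumW => sum18.
have : 0 <= \sum_(w' | (w' != 0) && (dot w' d == 0) && (w' \notin W)) g w'.
  by apply: sumr_ge0 => w' /andP[/andP[w'N0 _] _]; rewrite subr_ge0 plane_card_ge.
by move: sum18; move: (\sum_(_ | _) _) => r; rewrite /g; move: (plane_card _ _) => n; lia.
Qed.

(** * Tangents of a plane, counted with multiplicity 42 *)

Definition tangents w c : int :=
  \sum_(d | (d != 0) && (dot w d == 0)) \sum_(p | dot w p == c)
    (line_card p d == 1)%:R.

Lemma sum_flags w c (x : int) : w != 0 ->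
  \sum_(d | (d != 0) && (dot w d == 0)) \sum_(p | dot w p == c) x = x * 2352.
Proof.
move=> wN0; rewrite !sum_constz card_plane //.
rewrite (@eq_card _ _ [pred d | (d != 0) && (dot d w == 0)]) => [|d]; last first.
  by rewrite !inE unfold_in dotC.
rewrite cardZ_orth //; ring.
Qed.

(** The quadratic 276 x - 30 x^2 - 54 passes through the extreme values -54, 504 and 0 of t (8 x -
    3) at x = 0, 3 and 9. The lower bound on t serves x = 0, where 8 x - 3 < 0; the upper bound
    serves x = 1, 2, 3. *)
Lemma tangents_bound w c : w != 0 ->
  let x := plane_card w c - 13 in
  tangents w c * (8 * x - 3) <= 42 * (276 * x - 30 * x ^+ 2 - 54).
Proof.
move=> wN0.
have S1 := sum_line_card c wN0.
have S2 := sum_sqr_line_card c wN0.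
have poly x y z : \sum_(d | (d != 0) && (dot w d == 0)) \sum_(p | dot w p == c)
    (x + y * line_card p d + z * line_card p d ^+ 2)
    = x * 2352 + y * (336 * plane_card w c)
      + z * (336 * plane_card w c + 42 * (plane_card w c * (plane_card w c - 1))).
  rewrite -S2 -S1 -(sum_flags c x wN0) !big_distrr /= -!big_split /=.
  apply: eq_bigr => d _.
  by rewrite !big_distrr /= -!big_split.
have upper : 6 * tangents w c <= 12 * 2352 + (- 7) * (336 * plane_card w c)
      + 1 * (336 * plane_card w c + 42 * (plane_card w c * (plane_card w c - 1))).
  rewrite -poly /tangents big_distrr /=; apply: ler_sum => d /andP[dN0 _].
  rewrite big_distrr /=; apply: ler_sum => p _.
  by case/andP: (indicator1_bounds (line_card_bounds p dN0)).
have lower : 14 * 2352 + (- 9) * (336 * plane_card w c)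
      + 1 * (336 * plane_card w c + 42 * (plane_card w c * (plane_card w c - 1)))
      <= 6 * tangents w c.
  rewrite -poly /tangents big_distrr /=; apply: ler_sum => d /andP[dN0 _].
  rewrite big_distrr /=; apply: ler_sum => p _.
  by case/andP: (indicator1_bounds (line_card_bounds p dN0)).
have heavy : 16 < plane_card w c -> tangents w c = 0.
  move=> gt16; apply: big1 => d /andP[dN0 /eqP wd0]; apply: big1 => p /eqP wp.
  case: eqP => // /(tangent_plane_card wN0 dN0 wd0); rewrite wp; lia.
have := plane_card_ge c wN0; have := plane_card_le c wN0.
move: heavy upper lower; move: (plane_card w c) (tangents w c) => n t.
move=> heavy upper lower n_le n_ge.
have : n = 13 \/ n = 14 \/ n = 15 \/ n = 16 \/ (16 < n) by lia.
case=> [n_eq|[n_eq|[n_eq|[n_eq|n_gt]]]]; try (subst n; lia).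
(* Here x is between 4 and 9, where the concave quadratic is nonnegative. *)
by rewrite heavy // /=; nia.
Qed.

(** Summing tangent by tangent, each one contributes 8 * 18 - 3 * 48 = 0. *)
Lemma sum_tangents_excess :
  \sum_(w | w != 0) \sum_c tangents w c * (8 * (plane_card w c - 13) - 3) = 0.
Proof.
pose h w c : int := 8 * (plane_card w c - 13) - 3.
transitivity (\sum_(d | d != 0) \sum_p (line_card p d == 1)%:R *
    \sum_(w | (w != 0) && (dot w d == 0)) h w (dot w p)).
  transitivity (\sum_(w | w != 0) \sum_(d | (d != 0) && (dot w d == 0)) \sum_p
      (line_card p d == 1)%:R * h w (dot w p)).
    apply: eq_bigr => w _; under eq_bigr do rewrite /tangents big_distrl /=.
    rewrite exchange_big /=; apply: eq_bigr => d _.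
    rewrite [RHS](partition_big (dot w) xpredT) //=; apply: eq_bigr => c _.
    by rewrite big_distrl /=; apply: eq_bigr => p /eqP ->.
  rewrite (exchange_big_dep (fun d => d != 0)) /= => [|w d _ /andP[] //].
  apply: eq_bigr => d dN0; rewrite exchange_big /=; apply: eq_bigr => p _.
  by rewrite big_distrr /=; apply: eq_bigl => w; rewrite dN0.
apply: big1 => d dN0; apply: big1 => p _.
case: eqP => [k1|]; last by rewrite mul0r.
rewrite mul1r /h sumrB -big_distrr /= sumrB sum_planes_through_line // k1.
by rewrite !sum_constz cardZ_orth.
Qed.

(** * Contradiction from the first two moments of the plane sizes *)

Lemma no_blocking_set_card100 : False.
Proof.
have cardV1 : #|[pred w : V | w != 0]| = 342%N.
  have -> : (342 = (#|F| ^ (1 * 3)).-1)%N by rewrite card_F.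
  by rewrite -card_mx -(cardC1 (0 : V)).
have moments (x y z : int) : \sum_(w : V | w != 0) \sum_c
    (x * plane_card w c - y * plane_card w c ^+ 2 - z)
    = x * 100 * 342 - y * (5094 * 100) - z * 7 * 342.
  rewrite (eq_bigr (fun w => x * 100 - y * (\sum_c plane_card w c ^+ 2) - z * 7)).
    by rewrite !sumrB -[X in _ - X - _]big_distrr /= sum_sqr_plane_card !sum_constz cardV1.
  by move=> w _; rewrite !sumrB -!big_distrr /= sum_plane_card sum_constz card_F.
(* The quadratic bound rewritten in n = x + 13: 276 x - 30 x^2 - 54 = 1056 n - 30 n^2 - 8712. *)
have : \sum_(w : V | w != 0) \sum_c tangents w c * (8 * (plane_card w c - 13) - 3)
    <= \sum_(w : V | w != 0) \sum_c
        (42 * 1056 * plane_card w c - 42 * 30 * plane_card w c ^+ 2 - 42 * 8712).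
  apply: ler_sum => w wN0; apply: ler_sum => c _.
  by have := tangents_bound c wN0 => /=; lia.
by rewrite sum_tangents_excess moments; lia.
Qed.

End BlockingSet.

Theorem theorem1p6 : (r_ 7 7 3 < 243)%N.
Proof.
rewrite ltnS; apply/bigmax_leqP => A freeA; rewrite leqNgt; apply/negP.
move=> /card_geqP[s [s_uniq s_size sA]].
(* Only 243 points of [A] are kept, so that the complement has exactly 343 - 243 = 100 points; it
   still meets every line. *)
pose B := ~: [set p in s].
have cardB : #|B| = 100%N.
  apply/eqP; rewrite -(eqn_add2l #|[set p in s]|) cardsC cardsE (card_uniqP s_uniq).
  by rewrite s_size card_mx card_Fp.
apply: (@no_blocking_set_card100 'F_7 _ B cardB) => [|a d dN0]; first exact: card_Fp.
have /forallP/(_ a)/forallP/(_ d) := freeA.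
rewrite dN0 /= => /subsetPn[_ /imsetP[i _ ->] notA].
exists (i%:R); rewrite scaler_nat !inE; apply: contra notA; exact: sA.
Qed.
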